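(* Let $m\le 2g-1$ be the smallest pole number at $P$ that is not divisible by the characteristic $p$. Then there is a faithful representation $$\rho: G_1(P)\to \mathrm{GL}\big(L(mP)\big).$$
   Context: $C$ is a nonsingular complete curve of genus $g$ over an algebraically closed field $k$ of characteristic $p>0$, $G$ is a finite subgroup of $\mathrm{Aut}(C)$, and $P$ is a wildly ramified point of $C$ for $G$. $G_0(P)$ is the decomposition group (stabilizer) of $P$ in $G$, and $G_1(P)$ is its $p$-part, i.e. the first ramification group. $L(iP)=\{f\in k(C):\mathrm{div}(f)+iP\ge0\}$. A pole number at $P$ is an integer $i\ge 0$ such that $i=0$ or $L((i-1)P)\subsetneq L(iP)$. *)

(* Defs.v *)
From HB Require Import structures.
From mathcomp Require Import all_boot all_order all_algebra finmap.
From mathcomp Require Import boolp classical_sets cardinality constructive_ereal.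

Set Implicit Arguments.
Unset Strict Implicit.
Unset Printing Implicit Defensive.

Import Order.TTheory GRing.Theory Num.Theory.
Local Open Scope ring_scope.

Record sub_of (T : Type) (S : {pred T}) : Type :=
  SubOf { sub_val : T; sub_valP : sub_val \in S }.

HB.instance Definition _ (T : Type) (S : {pred T}) :=
  [isSub for @sub_val T S].
HB.instance Definition _ (T : choiceType) (S : {pred T}) :=
  [Choice of sub_of S by <:].

Lemma sub_of_group_closed (T : groupType) (S : groupClosed T) :
  group_closed (fun x : T => x \in S).
Proof. by split; [exact: gpred1 | exact: gpredF]. Qed.

HB.instance Definition _ (T : groupType) (S : groupClosed T) :=
  SubChoice_isSubGroup.Build T (fun x : T => x \in S) (sub_of S)
    (sub_of_group_closed S).

Lemma sub_of_submod_closed (R : nzRingType) (V : lmodType R)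
  (S : submodClosed V) : subsemimod_closed (fun x : V => x \in S).
Proof. by split; [split; [exact: rpred0 | exact: rpredD] | exact: rpredZ]. Qed.

HB.instance Definition _ (R : nzRingType) (V : lmodType R)
    (S : submodClosed V) :=
  GRing.SubChoice_isSubLmodule.Build R V (fun x : V => x \in S) (sub_of S)
    (sub_of_submod_closed S).

Record GL (R : nzRingType) (V : lmodType R) : Type := MkGL {
  GL_fun :> V -> V;
  GL_bij : bijective GL_fun;
  GL_linear : linear GL_fun }.

Section GLGroup.
Context (R : nzRingType) (V : lmodType R).
Implicit Types s t : GL V.

HB.instance Definition _ := gen_eqMixin (GL V).
HB.instance Definition _ := gen_choiceMixin (GL V).

Lemma GL_eqP s t : s =1 t -> s = t.
Proof.
case: s t => [f bf lf] [g bg lg] /= /funext fg; rewrite -fg in bg lg *.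
by congr MkGL; exact: Prop_irrelevance.
Qed.

Definition GL1 : GL V.
Proof. by apply: (@MkGL R V id) => //; exists id. Defined.

Definition GL_mul s t : GL V.
Proof.
apply: (@MkGL R V (fun x => s (t x))).
  exact: bij_comp (GL_bij s) (GL_bij t).
by move=> a u v; rewrite !GL_linear.
Defined.

Lemma GL_inv_subproof s : {g | cancel s g & cancel g s}.
Proof. by apply: cid2; case: (GL_bij s) => g sg gs; exists g. Qed.

Definition GL_inv s : GL V.
Proof.
case: (GL_inv_subproof s) => g sg gs; apply: (@MkGL R V g); first by exists s.
by move=> a u v; apply: (can_inj sg); rewrite GL_linear !gs.
Defined.

Lemma GL_invK s : cancel s (GL_inv s).
Proof. by rewrite /GL_inv; case: (GL_inv_subproof s). Qed.

Lemma GL_Kinv s : cancel (GL_inv s) s.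
Proof. by rewrite /GL_inv; case: (GL_inv_subproof s). Qed.

Fact GL_mulA : associative GL_mul. Proof. by move=> s t u; exact: GL_eqP. Qed.
Fact GL_mul1 : left_id GL1 GL_mul. Proof. by move=> s; exact: GL_eqP. Qed.
Fact GL_mulr1 : right_id GL1 GL_mul. Proof. by move=> s; exact: GL_eqP. Qed.
Fact GL_mulV : left_inverse GL1 GL_inv GL_mul.
Proof. by move=> s; apply: GL_eqP => x /=; rewrite GL_invK. Qed.
Fact GL_mulrV : right_inverse GL1 GL_inv GL_mul.
Proof. by move=> s; apply: GL_eqP => x /=; rewrite GL_Kinv. Qed.

HB.instance Definition _ :=
  isGroup.Build (GL V) GL_mulA GL_mul1 GL_mulr1 GL_mulV GL_mulrV.

End GLGroup.

Definition has_dim (R : nzRingType) (V : lmodType R) (n : nat) : Prop :=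
  exists e : 'I_n -> V, bijective (fun c : 'rV[R]_n => \sum_i c 0 i *: e i).

(** A nonsingular complete curve C over an algebraically closed field k is given
by its function field K = k(C), a finitely generated extension of k of
transcendence degree 1: the points of C are the discrete valuations of K that
are trivial on k, and the automorphisms of C are those of the k-algebra K
(Hartshorne, Algebraic Geometry, I.6). *)

#[short(type="fieldAlgType")]
HB.structure Definition FieldAlgebra (k : closedFieldType) :=
  {K of GRing.Field K & GRing.ComUnitAlgebra k K}.

Definition in_simple_ext (k : closedFieldType) (K : fieldAlgType k) (x z : K) :
    Prop :=
  exists a b : {poly k}, horner_alg x b != 0
    /\ z = horner_alg x a / horner_alg x b.

HB.mixin Record isFunctionField (k : closedFieldType) K
    of FieldAlgebra k K := {
  function_field_subproof : exists2 x : K,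
    ~ algebraicOver (in_alg K) x &
    exists (n : nat) (e : 'I_n -> K), forall z : K,
      exists2 c : 'I_n -> K,
        forall i, in_simple_ext x (c i) & z = \sum_i c i * e i }.

#[short(type="functionFieldType")]
HB.structure Definition FunctionField (k : closedFieldType) :=
  {K of isFunctionField k K & FieldAlgebra k K}.

Record curve_point (k : closedFieldType) (K : functionFieldType k) : Type :=
  Point {
  ord :> K -> \bar int;
  ord_eqy : forall f, ord f = +oo%E <-> f = 0;
  ordM : forall f h, ord (f * h) = (ord f + ord h)%E;
  ordD : forall f h, (Order.min (ord f) (ord h) <= ord (f + h)%R)%E;
  ord_cst : forall c : k, c != 0 -> ord c%:A = 0%E;
  ord_uniformizer : exists t, ord t = 1%E }.

HB.instance Definition _ (k : closedFieldType) (K : functionFieldType k) :=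
  gen_eqMixin (curve_point K).
HB.instance Definition _ (k : closedFieldType) (K : functionFieldType k) :=
  gen_choiceMixin (curve_point K).

Section PointTheory.
Context (k : closedFieldType) (K : functionFieldType k).
Implicit Types (P Q : curve_point K) (f h : K).

Lemma point_eqP P Q : P =1 Q -> P = Q.
Proof.
case: P Q => [v v0 vM vD vc vt] [w w0 wM wD wc wt] /= /funext vw.
rewrite -vw in w0 wM wD wc wt *.
by congr Point; exact: Prop_irrelevance.
Qed.

Lemma ord0 P : P 0 = +oo%E.
Proof. exact/ord_eqy. Qed.

Lemma ordZ P (a : k) f : (P f <= P (a *: f)%R)%E.
Proof.
have [->|a0] := eqVneq a 0; first by rewrite scale0r ord0 leey.
by rewrite -[f in leRHS]mul1r scalerAl ordM ord_cst// add0e.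
Qed.

Lemma ordB P f h : (Order.min (P f) (P h) <= P (f - h)%R)%E.
Proof.
apply: le_trans (ordD P _ _); rewrite le_min ge_min lexx/= ge_min.
by rewrite -scaleN1r ordZ orbT.
Qed.

End PointTheory.

Record curve_aut (k : closedFieldType) (K : functionFieldType k) : Type :=
  CurveAut {
    aut_fun :> K -> K;
    aut_bij : bijective aut_fun;
    aut_linear : linear aut_fun;
    aut1 : aut_fun 1 = 1;
    autM : {morph aut_fun : f h / f * h} }.

Section CurveAutGroup.
Context (k : closedFieldType) (K : functionFieldType k).
Implicit Types (s t : curve_aut K) (P : curve_point K).

HB.instance Definition _ := gen_eqMixin (curve_aut K).
HB.instance Definition _ := gen_choiceMixin (curve_aut K).

HB.instance Definition _ s := GRing.isLinear.Build k K K *:%R s (aut_linear s).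
HB.instance Definition _ s :=
  GRing.isMonoidMorphism.Build K K s (aut1 s, autM s).

Lemma aut_eqP s t : s =1 t -> s = t.
Proof.
case: s t => [f bf lf f1 fM] [g bg lg g1 gM] /= /funext fg.
rewrite -fg in bg lg g1 gM *.
by congr CurveAut; exact: Prop_irrelevance.
Qed.

Definition aut_one : curve_aut K.
Proof. by apply: (@CurveAut k K id) => //; exists id. Defined.

Definition aut_mul s t : curve_aut K.
Proof.
apply: (@CurveAut k K (fun f => s (t f))).
- exact: bij_comp (aut_bij s) (aut_bij t).
- by move=> a u v; rewrite !aut_linear.
- by rewrite !aut1.
- by move=> f h; rewrite !autM.
Defined.

Lemma aut_inv_subproof s : {g | cancel s g & cancel g s}.
Proof. by apply: cid2; case: (aut_bij s) => g sg gs; exists g. Qed.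

Definition aut_inv s : curve_aut K.
Proof.
case: (aut_inv_subproof s) => g sg gs; apply: (@CurveAut k K g).
- by exists s.
- by move=> a u v; apply: (can_inj sg); rewrite aut_linear !gs.
- by apply: (can_inj sg); rewrite gs aut1.
- by move=> f h; apply: (can_inj sg); rewrite autM !gs.
Defined.

Lemma aut_invK s : cancel s (aut_inv s).
Proof. by rewrite /aut_inv; case: (aut_inv_subproof s). Qed.

Lemma aut_Kinv s : cancel (aut_inv s) s.
Proof. by rewrite /aut_inv; case: (aut_inv_subproof s). Qed.

Fact aut_mulA : associative aut_mul.
Proof. by move=> s t u; exact: aut_eqP. Qed.
Fact aut_mul1 : left_id aut_one aut_mul.
Proof. by move=> s; exact: aut_eqP. Qed.
Fact aut_mulr1 : right_id aut_one aut_mul.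
Proof. by move=> s; exact: aut_eqP. Qed.
Fact aut_mulV : left_inverse aut_one aut_inv aut_mul.
Proof. by move=> s; apply: aut_eqP => x /=; rewrite aut_invK. Qed.
Fact aut_mulrV : right_inverse aut_one aut_inv aut_mul.
Proof. by move=> s; apply: aut_eqP => x /=; rewrite aut_Kinv. Qed.

HB.instance Definition _ :=
  isGroup.Build (curve_aut K) aut_mulA aut_mul1 aut_mulr1 aut_mulV aut_mulrV.

(* An automorphism s of C acts on functions by f |-> f \o s^-1, so that the
   order of f at s(P) is the order at P of the image of f under s^-1. *)
Definition act_point s P : curve_point K.
Proof.
apply: (@Point k K (fun f => P (aut_inv s f))).
- move=> f; split=> [/ord_eqy/(congr1 s)|->]; first by rewrite aut_Kinv raddf0.
  by rewrite raddf0 ord0.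
- by move=> f h; rewrite autM ordM.
- by move=> f h; rewrite raddfD; exact: ordD.
- by move=> c c0; rewrite linearZ/= aut1 ord_cst.
- by have [t Pt] := ord_uniformizer P; exists (s t); rewrite aut_invK.
Defined.

End CurveAutGroup.

Definition divisor (k : closedFieldType) (K : functionFieldType k) : Type :=
  {fsfun curve_point K -> int with 0}.

Section Divisors.
Context (k : closedFieldType) (K : functionFieldType k).
Implicit Types (P Q : curve_point K) (D : divisor K) (f : K).

(* All points have degree 1, since k is algebraically closed. *)
Definition deg D : int := \sum_(Q <- finsupp D) D Q.

Definition mul_point (i : int) P : divisor K := [fsfun [fsfun] with P |-> i].

(* L(D) = {f | div(f) + D >= 0}; the zero function belongs to it because its
   order is +oo everywhere. *)
Definition RRspace D : {pred K} :=
  [pred f | `[< forall Q, (0 <= Q f + (D Q)%:E)%E >]].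

Lemma RRspace_submod_closed D : submod_closed (RRspace D).
Proof.
split=> [|a u v /asboolP Du /asboolP Dv]; apply/asboolP => Q.
  by rewrite ord0 addye// leey.
have minD : (Order.min (Q u) (Q v) <= Q (a *: u + v)%R)%E.
  by apply: le_trans (ordD _ _ _); rewrite le_min !ge_min ordZ lexx orbT.
apply: le_trans (leeD2r _ minD).
by case: (leP (Q u) (Q v)).
Qed.

HB.instance Definition _ D :=
  GRing.isSubmodClosed.Build k K (RRspace D) (RRspace_submod_closed D).

(* Riemann's definition: g is the maximum of deg D + 1 - l(D) over all
   divisors D. *)
Definition has_genus (g : nat) : Prop :=
  (forall D l, has_dim (sub_of (RRspace D)) l -> deg D + 1 - l%:Z <= g%:Z)
  /\ exists D l, has_dim (sub_of (RRspace D)) l /\ deg D + 1 - l%:Z = g%:Z.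

Definition pole_number P (i : nat) : Prop :=
  i = 0%N \/ ([set` RRspace (mul_point (i%:Z - 1) P)]
                `<` [set` RRspace (mul_point i%:Z P)])%classic.

Definition smallest_prime_to_pole_number (p : nat) P (m : nat) : Prop :=
  [/\ pole_number P m, ~~ (p %| m)%N &
      forall i, pole_number P i -> ~~ (p %| i)%N -> (m <= i)%N].

End Divisors.

Section Ramification.
Context (k : closedFieldType) (K : functionFieldType k).
Implicit Types (G : groupClosed (curve_aut K)) (P : curve_point K).

Definition decomposition_group G P : {pred curve_aut K} :=
  [pred s | (s \in G) && `[< act_point s P = P >]].

(* G_i(P): the elements of G_0(P) acting trivially on O_P / m_P^(i+1); for
   i = 1 it is the p-Sylow subgroup of G_0(P). *)
Definition ramification_group G (i : nat) P : {pred curve_aut K} :=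
  [pred s | (s \in decomposition_group G P) &&
    `[< forall f : K, (0 <= P f)%E -> ((i.+1)%:Z%:E <= P (s f - f)%R)%E >]].

Lemma in_decomposition_group G P s : reflect
  (s \in G /\ forall f, P (s f) = P f) (s \in decomposition_group G P).
Proof.
apply: (iffP andP) => -[sG sP]; split=> //.
  by move=> f; move/asboolP: sP => sP; rewrite -[in LHS]sP/= aut_invK.
by apply/asboolP/point_eqP => f /=; rewrite -sP aut_Kinv.
Qed.

Lemma decomposition_group_closed G P : group_closed (decomposition_group G P).
Proof.
split; first by apply/in_decomposition_group; split=> //; exact: gpred1.
move=> s t /in_decomposition_group[sG sP] /in_decomposition_group[tG tP].
apply/in_decomposition_group; split=> [|f]; first exact: gpredF.
by rewrite -[in RHS](aut_Kinv t f) tP -[RHS]sP.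
Qed.

Lemma ramification_group_closed G i P :
  group_closed (ramification_group G i P).
Proof.
have [D1 DF] := decomposition_group_closed G P; split.
  by apply/andP; split=> //; apply/asboolP => f _; rewrite subrr ord0 leey.
move=> s t /andP[Ds /asboolP si] /andP[Dt /asboolP ti].
apply/andP; split; first exact: DF.
have [[_ sP] [_ tP]] :=
  (in_decomposition_group _ _ _ Ds, in_decomposition_group _ _ _ Dt).
apply/asboolP => f f0; pose h := aut_inv t f.
have h0 : (0 <= P h)%E by rewrite -tP aut_Kinv.
have -> : (s / t)%g f - f = (s h - h) - (t h - h).
  by rewrite [t h]aut_Kinv opprB addrA addrNK.
by apply: le_trans (ordB _ _ _); rewrite le_min si// ti.
Qed.

HB.instance Definition _ G P :=
  isMulClosed.Build (curve_aut K) (decomposition_group G P)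
    (group_closedM (decomposition_group_closed G P)).
HB.instance Definition _ G P :=
  isMul1Closed.Build (curve_aut K) (decomposition_group G P)
    (decomposition_group_closed G P).1.
HB.instance Definition _ G P :=
  isInvClosed.Build (curve_aut K) (decomposition_group G P)
    (group_closedV (decomposition_group_closed G P)).

HB.instance Definition _ G i P :=
  isMulClosed.Build (curve_aut K) (ramification_group G i P)
    (group_closedM (ramification_group_closed G i P)).
HB.instance Definition _ G i P :=
  isMul1Closed.Build (curve_aut K) (ramification_group G i P)
    (ramification_group_closed G i P).1.
HB.instance Definition _ G i P :=
  isInvClosed.Build (curve_aut K) (ramification_group G i P)
    (group_closedV (ramification_group_closed G i P)).

(* e is the ramification index at P of the quotient C -> C / G: the function
   field of C / G is the fixed field of G in K, on which ord_P has image
   e Z. *)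
Definition ramification_index G P (e : nat) : Prop :=
  (0 < e)%N /\ forall n : int,
    (exists2 f : K, forall s, s \in G -> s f = f & P f = n%:E)
      <-> (e%:Z %| n)%Z.

Definition wildly_ramified (p : nat) G P : Prop :=
  exists2 e, ramification_index G P e & (p %| e)%N.

End Ramification.

(* Main.v *)
Require Import Defs.
From HB Require Import structures.
From mathcomp Require Import all_boot all_order all_algebra finmap.
From mathcomp Require Import boolp classical_sets cardinality.
From mathcomp Require Import constructive_ereal ring.

Set Implicit Arguments.
Unset Strict Implicit.
Unset Printing Implicit Defensive.

Import Order.TTheory GRing.Theory Num.Theory.
Local Open Scope ring_scope.

(** An automorphism [s] fixing [P] permutes the other points, so it maps
[L(m P)] to itself; this is the representation. It is faithful because an
element [s] of the first ramification group that acts trivially on [L(m P)]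
is the identity. Indeed, [m] being a pole number, [L(m P)] contains a function
[f] with a pole of order exactly [m] at [P], and [s f = f]. Let [t] be a
uniformizer at [P], [w = s t / t], and [u = f t^m], a unit at [P]. Then
[s u / u = w^m], where [w] is congruent to 1 because [s] is in the first
ramification group; since [p] does not divide [m], [w^m - 1] and [w - 1] have
the same order at [P] ([ordX_sub_one]), that is,

   [ord (s t - t) = ord (s u - u) + 1].

Suppose now that [ord (s x - x) >= j] for all [x] regular at [P]. Taking [x = u]
gives [ord (s t - t) >= j + 1], and writing any regular [x] as [c + t y] with
[c] constant and [y] regular gives [ord (s x - x) >= j + 1]. Hence [j] can be
increased without bound, so that [s] fixes every regular [x], and then all of
[K], in which each element or its inverse is regular
([aut_eq1_of_fixed_pole]).

The decomposition [x = c + t y] says that the residue field at [P] is the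
constant field [k] ([residue_field]). If no [c] existed, then, [k] being
algebraically closed, every nonzero polynomial in [x] would have order 0 at
[P], and [x], [t] would be algebraically independent over [k]: in a polynomial
relation, written in powers of [t], the term of lowest degree in [t] could not
be cancelled. But any two functions on a curve are algebraically dependent
([algebraic_dependence]). This is a dimension count: for [K] spanned by [n]
elements over [k(x0)], after clearing denominators the [N^2] monomials
[x^i t^j] with [i, j < N] lie in a space of dimension linear in [N]. *)

(** * Algebraic dependence of two functions *)

Lemma linear_dependence (F : fieldType) (V : lmodType F) (I J : finType)
    (b : J -> V) (w : I -> V) :
    (forall i, exists c : J -> F, w i = \sum_j c j *: b j) ->
    (#|J| < #|I|)%N ->
  exists2 u : I -> F, exists i, u i != 0 & \sum_i u i *: w i = 0.
Proof.
move=> /choice[c wE] ltJI.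
pose A := \matrix_(i < #|I|, j < #|J|) c (enum_val i) (enum_val j).
have : kermx A != 0.
  rewrite kermx_eq0; apply: contraL ltJI => /eqP rkA.
  by rewrite -leqNgt -[#|I|]rkA rank_leq_col.
case/matrix0Pn => i0 [j0 Aij]; pose v := row i0 (kermx A).
have vA : v *m A = 0 by rewrite -row_mul mulmx_ker row0.
exists (fun i => v 0 (enum_rank i)).
  by exists (enum_val j0); rewrite enum_valK mxE.
under eq_bigr do rewrite wE scaler_sumr.
rewrite exchange_big big1// => j _; under eq_bigr do rewrite scalerA.
rewrite -scaler_suml; have /rowP/(_ (enum_rank j)) := vA.
rewrite mxE [RHS]mxE (reindex _ (onW_bij _ (@enum_rank_bij I))).
under eq_bigr do rewrite [A _ _]mxE !enum_rankK.
by move=> ->; rewrite scale0r.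
Qed.

Section AlgebraicDependence.
Context (k : closedFieldType) (K : fieldAlgType k) (x0 : K) (n : nat)
  (e : 'I_n -> K).

Local Notation h := (horner_alg (A:=K) x0).

(** The degree filtration on the [k[x0]]-span of the generators; the bound is
strict, so that step [D] has dimension at most [n * D] over [k]. *)
Definition poly_span (D : nat) (w : K) : Prop :=
  exists2 q : 'I_n -> {poly k},
    forall l, (size (q l) <= D)%N & w = \sum_l h (q l) * e l.

Lemma poly_spanW D D' w : (D <= D')%N -> poly_span D w -> poly_span D' w.
Proof. by move=> DD' [q sq ->]; exists q => // l; apply: leq_trans DD'. Qed.

Lemma poly_span_sum (I : finType) D (w : I -> K) :
  (forall i, poly_span D (w i)) -> poly_span D (\sum_i w i).
Proof.
move=> Dw; have /choice[q qP] : forall i, exists q : 'I_n -> {poly k},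
    (forall l, (size (q l) <= D)%N) /\ w i = \sum_l h (q l) * e l.
  by move=> i; have [q] := Dw i; exists q.
exists (fun l => \sum_i q i l) => [l|].
  apply: leq_trans (size_sum _ _ _) _; apply/bigmax_leqP => i _.
  by case: (qP i).
under eq_bigr do rewrite (qP _).2.
by rewrite exchange_big; apply: eq_bigr => l _; rewrite raddf_sum mulr_suml.
Qed.

Lemma poly_spanM D C (p : {poly k}) w : (size p <= C)%N -> poly_span D w ->
  poly_span (D + C) (h p * w).
Proof.
move=> sp [q sq ->]; exists (fun l => p * q l) => [l|].
  apply: leq_trans (size_polyMleq _ _) _; apply: leq_trans (leq_pred _) _.
  by rewrite addnC leq_add.
by rewrite mulr_sumr; apply: eq_bigr => l _; rewrite mulrA -rmorphM.
Qed.

Lemma poly_span_coef D w : poly_span D w -> exists c : 'I_n * 'I_D -> k,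
  w = \sum_j c j *: (x0 ^+ j.2 * e j.1).
Proof.
move=> [q sq ->]; exists (fun j : 'I_n * 'I_D => (q j.1)`_j.2).
rewrite -(pair_bigA _ (fun l r => (q l)`_(r : 'I_D) *: (x0 ^+ r * e l)))/=.
apply: eq_bigr => l _; rewrite /horner_alg /horner_morph.
rewrite (@horner_coef_wide _ D); last first.
  by rewrite (leq_trans (size_poly _ _)).
rewrite mulr_suml; apply: eq_bigr => r _.
by rewrite coef_map mulr_algl scalerAl.
Qed.

Context (e_span : forall z : K, exists2 c : 'I_n -> K,
  forall i, in_simple_ext x0 (c i) & z = \sum_i c i * e i).

Lemma common_denominator (I : finType) (y : I -> K) :
    (forall i, exists2 d, h d != 0 & exists C, poly_span C (h d * y i)) ->
  exists2 d, h d != 0 & exists C, forall i, poly_span C (h d * y i).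
Proof.
move=> yP.
have /choice[d dP] i : exists d, h d != 0 /\ exists C, poly_span C (h d * y i).
  by have [d] := yP i; exists d.
have /choice[C CP] i : exists C, poly_span C (h (d i) * y i) := (dP i).2.
pose r i := \prod_(j | j != i) d j.
exists (\prod_i d i).
  by rewrite rmorph_prod; apply/prodf_neq0 => i _; exact: (dP i).1.
exists (\max_i (C i + size (r i)))%N => i.
apply: (@poly_spanW (C i + size (r i))).
  exact: (leq_bigmax (F := fun i => C i + size (r i))%N).
rewrite (bigD1 i)//= -/(r i) mulrC rmorphM mulrA [y i * _]mulrC mulrC.
exact: poly_spanM.
Qed.

Lemma poly_span_denominator z :
  exists2 d, h d != 0 & exists C, poly_span C (h d * z).
Proof.
have [c cP ->] := e_span z.
have [i|d d0 [C CP]] := @common_denominator _ (fun i => c i * e i).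
  have [a [b [b0 cE]]] := cP i; exists b => //; exists (size a).
  exists (fun l => if l == i then a else 0) => [l|].
    by case: eqP => // _; rewrite size_poly0.
  rewrite (bigD1 i)//= eqxx big1 => [|l /negPf->]; last by rewrite raddf0 mul0r.
  by rewrite addr0 cE mulrA mulrCA divff// mulr1.
exists d => //; exists C; rewrite mulr_sumr; exact: poly_span_sum.
Qed.

(** Such [y] form a filtered ring, so the degree needed for a monomial in them
grows linearly with its exponents. *)
Definition span_shift (C : nat) (y : K) : Prop :=
  forall D w, poly_span D w -> poly_span (D + C) (y * w).

Lemma span_shiftM C C' y y' :
  span_shift C y -> span_shift C' y' -> span_shift (C + C') (y * y').
Proof.
by move=> yC yC' D w Dw; rewrite [(C + _)%N]addnC addnA -mulrA; apply/yC/yC'.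
Qed.

Lemma span_shiftX C y i : span_shift C y -> span_shift (C * i) (y ^+ i).
Proof.
move=> yC; elim: i => [|i IHi]; first by move=> D w; rewrite muln0 addn0 mul1r.
by rewrite mulnS exprS; apply: span_shiftM.
Qed.

(** Both [d] and [d * y] are needed: by multiplying with [d ^+ (N - i)], all
powers [y ^+ i] for [i <= N] get the same denominator [d ^+ N]. *)
Lemma span_shift_denominator y : exists2 d, h d != 0 &
  exists C, span_shift C (h d) /\ span_shift C (h d * y).
Proof.
have [d d0 [C CP]] := @common_denominator _ (fun l => y * e l)
  (fun l => poly_span_denominator _).
exists d => //; exists (size d + C)%N; split=> D w.
  move=> Dw; apply: poly_spanW (poly_spanM (leqnn _) Dw).
  by rewrite addnA leq_addr.
move=> [q sq ->]; rewrite mulr_sumr.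
apply: poly_span_sum => l; rewrite mulrCA -mulrA.
apply: poly_spanW (poly_spanM (sq l) (CP l)).
by rewrite addnC leq_add2l leq_addl.
Qed.

(** The relation is stated as a polynomial in [t] with coefficients in [k[x]],
the form in which valuations can be compared term by term. *)
Lemma algebraic_dependence (x t : K) :
  exists (N : nat) (q : 'I_N -> {poly k}),
    (exists j, q j != 0) /\ \sum_j horner_alg x (q j) * t ^+ j = 0.
Proof.
have [dx dx0 [Cx [dxC xC]]] := span_shift_denominator x.
have [dt dt0 [Ct [dtC tC]]] := span_shift_denominator t.
have [d1 d10 [D0 wD]] := poly_span_denominator 1; rewrite mulr1 in wD.
(* Large enough for [N * N] to exceed [n * (D0 + (Cx + Ct) * N)]. *)
pose N := (n * (D0 + (Cx + Ct))).+1; pose D := (D0 + (Cx + Ct) * N)%N.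
pose m (ij : 'I_N * 'I_N) := x ^+ ij.1 * t ^+ ij.2.
pose s := h dx ^+ N * h dt ^+ N * h d1.
have s0 : s != 0 by rewrite !mulf_neq0 ?expf_neq0.
have [ij||u [[i j] /= uij] su] := linear_dependence
  (b := fun j : 'I_n * 'I_D => x0 ^+ j.2 * e j.1) (w := fun ij => s * m ij).
- apply: poly_span_coef.
  have split_exp (y : K) (i : 'I_N) : y ^+ N = y ^+ i * y ^+ (N - i).
    by rewrite -exprD subnKC// ltnW.
  have -> : s * m ij = (h dx * x) ^+ ij.1 * h dx ^+ (N - ij.1) *
      ((h dt * t) ^+ ij.2 * h dt ^+ (N - ij.2)) * h d1.
    by rewrite /s (split_exp _ ij.1) (split_exp (h dt) ij.2) !exprMn /m; ring.
  have shiftN C a y (i : 'I_N) : span_shift C a -> span_shift C (a * y) ->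
      span_shift (C * N) ((a * y) ^+ i * a ^+ (N - i)).
    move=> aC ayC; have -> : (C * N = C * i + C * (N - i))%N.
      by rewrite -mulnDr subnKC// ltnW.
    by apply: span_shiftM; apply: span_shiftX.
  by rewrite /D mulnDl; apply: span_shiftM wD; apply: shiftN.
- rewrite !card_prod !card_ord /D.
  rewrite (@leq_trans (n * (D0 + (Cx + Ct)) * N).+1)//.
    rewrite ltnS -mulnA leq_mul2l [((D0 + _) * _)%N]mulnDl.
    by rewrite leq_add2r leq_pmulr ?orbT.
  by rewrite ltn_mul2r /= ltnSn.
exists N, (fun j => \poly_(i < N) u (inord i, j)); split.
  exists j; apply: contraNneq uij => /(congr1 (fun p : {poly k} => p`_i)).
  by rewrite coef_poly coef0 ltn_ord inord_val => ->.
apply: (mulfI s0); rewrite mulr0 -[RHS]su mulr_sumr.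
rewrite [RHS](eq_bigr (fun ij => u (ij.1, ij.2) *: (s * m (ij.1, ij.2)))).
  2: by case.
rewrite -(pair_bigA _ (fun i j => u (i, j) *: (s * m (i, j)))) exchange_big/=.
apply: eq_bigr => l _; rewrite poly_def raddf_sum mulr_suml mulr_sumr.
apply: eq_bigr => r _.
rewrite /m/= inord_val linearZ/= rmorphXn/= horner_algX mulr_algl.
by rewrite -!scalerAl -!scalerAr.
Qed.

End AlgebraicDependence.

(** * The valuation at a point and its residue field *)

Section Valuation.
Context (k : closedFieldType) (K : functionFieldType k) (P : curve_point K).
Implicit Types (f h x t : K).

Lemma ord_one : P 1 = 0%E.
Proof. by rewrite -[1]scale1r ord_cst// oner_neq0. Qed.

Lemma ordN f : P (- f) = P f.
Proof.
by rewrite -mulN1r ordM -scaleN1r ord_cst ?add0e// oppr_eq0 oner_eq0.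
Qed.

Lemma ordX_int f (a : int) i : P f = a%:E -> P (f ^+ i) = (a *+ i)%:E.
Proof.
move=> Pf; elim: i => [|i IHi]; first exact: ord_one.
by rewrite exprS ordM Pf IHi mulrS EFinD.
Qed.

Lemma ordX0 f i : P f = 0%E -> P (f ^+ i) = 0%E.
Proof. by move=> /ordX_int ->; rewrite mul0rn. Qed.

Lemma ordV_int f (a : int) : P f = a%:E -> P f^-1 = (- a)%:E.
Proof.
move=> Pf; have f0 : f != 0 by apply/eqP => f0; rewrite f0 Defs.ord0 in Pf.
have := ord_one; rewrite -(divff f0) ordM Pf.
case: (P f^-1) => // b; rewrite -EFinD => -[] /eqP.
by rewrite addrC addr_eq0 => /eqP->.
Qed.

Lemma le_ordD (a : \bar int) f h : (a <= P f -> a <= P h -> a <= P (f + h)%R)%E.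
Proof. by move=> af ah; apply: le_trans (ordD _ _ _); rewrite le_min af. Qed.

Lemma le_ord_sum (a : \bar int) (I : finType) (A : pred I) (F : I -> K) :
  (forall i, A i -> (a <= P (F i))%E) -> (a <= P (\sum_(i | A i) F i)%R)%E.
Proof.
move=> aF; elim/big_rec: _ => [|i x Ai ax]; first by rewrite Defs.ord0 leey.
by apply: le_ordD => //; apply: aF.
Qed.

Lemma ordD_eq0 f h : P f = 0%E -> (0 < P h)%E -> P (f + h) = 0%E.
Proof.
move=> Pf Ph; apply/eqP; rewrite eq_le; apply/andP; split; last first.
  by apply: le_ordD; [rewrite Pf | apply: ltW].
rewrite leNgt; apply/negP => Pfh; suff : (0 < P f)%E by rewrite Pf ltxx.
rewrite -[f](addrK h); apply: lt_le_trans (ordB _ _ _).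
by rewrite lt_min Pfh.
Qed.

Lemma eq0_of_le_ord f : (forall j : nat, (j%:Z%:E <= P f)%E) -> f = 0.
Proof.
move=> jf; apply/(ord_eqy P); case Pf : (P f) => [a| |] //.
  have := jf (`|a|.+1)%N; rewrite Pf lee_fin => /le_trans/(_ (lez_abs a)).
  by rewrite lez_nat ltnn.
by have := jf 0%N; rewrite Pf.
Qed.

(** The polynomial splits into linear factors. *)
Lemma ord_horner_eq0 x (q : {poly k}) :
  (forall c : k, P (x - c%:A) = 0%E) -> q != 0 -> P (horner_alg x q) = 0%E.
Proof.
move=> xc q0; have [r ->] := closed_field_poly_normal q.
rewrite linearZ/= mulr_algl -mulr_algl ordM ord_cst ?lead_coef_eq0// add0e.
rewrite rmorph_prod; elim/big_rec: _ => [|c y _ IH]; first exact: ord_one.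
by rewrite ordM rmorphB/= horner_algX horner_algC xc IH.
Qed.

(** Otherwise nonzero polynomials in [x] all have order 0 by
[ord_horner_eq0], which makes [x] and a uniformizer algebraically
independent. *)
Lemma residue_field x : (0 <= P x)%E -> exists c : k, (0 < P (x - c%:A)%R)%E.
Proof.
move=> Px; apply: contrapT => /forallNP noc.
have xc c : P (x - c%:A) = 0%E.
  apply/eqP; rewrite eq_le leNgt; apply/andP; split; first exact/negP/noc.
  apply: le_trans (ordB _ _ _); rewrite le_min Px/=.
  have [->|c0] := eqVneq c 0; first by rewrite scale0r Defs.ord0.
  by rewrite ord_cst.
have [t Pt] := ord_uniformizer P.
have [x0 _ [n [e eK]]] := @function_field_subproof k K.
have [N [q [[j1 qj1] qt]]] := algebraic_dependence eK x t.
(* The term of lowest degree in [t] has order [j], the others a larger one. *)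
case: (@arg_minnP _ j1 (fun j => q j != 0) (@nat_of_ord N)) => // j qj jmin.
have Ptj i : P (t ^+ i) = i%:Z%:E by rewrite (ordX_int _ Pt) natz.
have := Ptj j; rewrite -[LHS]add0e -(ord_horner_eq0 xc qj) -ordM.
move/eqP: qt; rewrite (bigD1 j)//= addr_eq0 => /eqP ->; rewrite ordN => Pj.
have : (j.+1%:Z%:E <= j%:Z%:E)%E; last by rewrite lee_fin lez_nat ltnn.
rewrite -Pj; apply: le_ord_sum => i ij.
have [->|qi] := eqVneq (q i) 0; first by rewrite raddf0 mul0r Defs.ord0 leey.
rewrite ordM ord_horner_eq0// add0e Ptj lee_fin lez_nat ltn_neqAle jmin// andbT.
by rewrite eq_sym.
Qed.

End Valuation.

(** * Automorphisms in the first ramification group *)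

Section FixedPole.
Context (k : closedFieldType) (p : nat) (hp : p \in [pchar k]).
Context (K : functionFieldType k) (P : curve_point K).

(** The cofactor [1 + w + ... + w^(m-1)] is congruent to [m], which is
nonzero in [k]. *)
Lemma ordX_sub_one (w : K) (m : nat) : ~~ (p %| m)%N -> (0 < P (w - 1)%R)%E ->
  P (w ^+ m - 1) = P (w - 1).
Proof.
move=> pm Pw; rewrite subrX1 ordM.
have w0 : P w = 0%E by rewrite -[w](subrK 1) addrC ordD_eq0 ?ord_one.
suff -> : P (\sum_(i < m) w ^+ i) = 0%E by rewrite adde0.
have -> : \sum_(i < m) w ^+ i = m%:R%:A + \sum_(i < m) (w ^+ i - 1).
  by rewrite sumrB sumr_const card_ord scaler_nat addrC subrK.
apply: ordD_eq0; first by rewrite ord_cst// -(dvdn_pcharf hp).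
apply: lt_le_trans Pw _; apply: le_ord_sum => i _.
rewrite subrX1 ordM leeDl//; apply: le_ord_sum => l _.
by rewrite (ordX0 _ w0).
Qed.

(** Comparing [s] on a uniformizer [t] and on the unit [f * t ^+ m] improves
any bound on the order of [s x - x] by one. The bound 2 starts the induction:
it makes [s t / t] congruent to 1. *)
Lemma aut_eq1_of_fixed_pole (s : curve_aut K) (f : K) (m : nat) :
    (forall x, P (s x) = P x) ->
    (forall x, (0 <= P x)%E -> (2%:Z%:E <= P (s x - x)%R)%E) ->
    s f = f -> P f = (- m%:Z)%:E -> ~~ (p %| m)%N ->
  s =1 id.
Proof.
move=> sP s2 sf Pf pm; have [t Pt] := ord_uniformizer P.
have t0 : t != 0 by apply/eqP => t0; rewrite t0 Defs.ord0 in Pt.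
have PtV := ordV_int Pt.
have sdiv (j : nat) x : (0 <= P x)%E -> (j.+2%:Z%:E <= P (s x - x)%R)%E.
  elim: j x => [|j IHj] x Px; first exact: s2.
  pose u := f * t ^+ m; pose w := s t / t.
  have Pu : P u = 0%E by rewrite ordM Pf (ordX_int _ Pt) -EFinD natz addNr.
  have wE : w - 1 = (s t - t) / t by rewrite mulrBl divff.
  have Pw : (0 < P (w - 1)%R)%E.
    rewrite wE ordM PtV; apply: lt_le_trans (leeD2r _ (s2 t _)) => //.
    by rewrite Pt.
  have su : s u - u = (w ^+ m - 1) * u.
    rewrite rmorphM rmorphXn/= sf mulrBl mul1r /u /w expr_div_n mulrCA.
    by rewrite divfK ?expf_neq0.
  have Pst : (j.+3%:Z%:E <= P (s t - t)%R)%E.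
    have := IHj u; rewrite Pu su => /(_ (lexx _)).
    rewrite ordM Pu adde0 ordX_sub_one// wE => /leeD2r -/(_ 1%E).
    by rewrite -{2}Pt -ordM divfK// -EFinD -PoszD addn1.
  have [c xc] := residue_field Px; pose y := (x - c%:A) / t.
  have Py : (0 <= P y)%E.
    rewrite ordM PtV; move: xc; case: (P _) => [a| |]//.
    by rewrite lte_fin -EFinD lee_fin subr_ge0.
  have -> : s x - x = (s t - t) * s y + t * (s y - y).
    have xE : x = c%:A + t * y by rewrite mulrC divfK// addrC subrK.
    have sxE : s x = c%:A + s t * s y.
      by rewrite [in LHS]xE linearD/= rmorphM linearZ/= aut1.
    by rewrite sxE [X in _ - X]xE; ring.
  apply: le_ordD; rewrite ordM.
    by rewrite -[leLHS]adde0; apply: leeD => //; rewrite sP.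
  by rewrite Pt intS EFinD leeD2l// IHj.
have sO x : (0 <= P x)%E -> s x = x.
  move=> Px; apply/eqP; rewrite -subr_eq0.
  apply/eqP/(@eq0_of_le_ord _ _ P) => j.
  by apply: le_trans (sdiv j x Px); rewrite lee_fin lez_nat -addn2 leq_addr.
move=> x; have [|Px] := leP 0%E (P x); first exact: sO.
have x0 : x != 0 by apply/eqP => x0; rewrite x0 Defs.ord0 in Px.
apply: invr_inj; rewrite -[LHS](fmorphV s)/= sO//.
case Pxa : (P x) Px => [a| |]// => [|_].
  by rewrite (ordV_int Pxa) lte_fin lee_fin oppr_ge0 => /ltW.
by have := ord_one P; rewrite -(divff x0) ordM Pxa; case: (P x^-1).
Qed.

End FixedPole.

(** * The spaces L(mP) *)

Section Poles.
Context (k : closedFieldType) (K : functionFieldType k).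
Implicit Types (P Q : curve_point K).

Lemma mul_pointE (i : int) P Q : mul_point i P Q = if Q == P then i else 0.
Proof. by rewrite fsfun_withE; case: eqP => // _; rewrite fsfun0E. Qed.

Lemma pole_number_witness P (m : nat) : pole_number P m -> (0 < m)%N ->
  exists2 f, f \in RRspace (mul_point m%:Z P) & P f = (- m%:Z)%:E.
Proof.
case=> [->//|[_ nsub] m0]; apply: contrapT => /forall2NP noP; apply: nsub.
move=> f fm; have {fm} /asboolP := fm => fm; apply/asboolP => Q.
have := fm Q; rewrite !mul_pointE; case: eqP => // -> Pf.
have [|PfN] := noP f; first by case; apply/asboolP.
move: Pf PfN; case: (P f) => [a| |]//.
rewrite -!EFinD !lee_fin -{1}[m%:Z]opprK subr_ge0 => + neq.
rewrite le_eqVlt => /orP[/eqP aE|]; first by rewrite aE in neq.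
by rewrite -lezD1 -(lerD2r m%:Z) addrAC addNr add0r addrA subr_ge0.
Qed.

Lemma aut_inv_inv (s : curve_aut K) f : aut_inv (aut_inv s) f = s f.
Proof. by rewrite -[LHS](aut_Kinv s) (aut_Kinv (aut_inv s)). Qed.

(** The order of [s f] at [Q] is that of [f] at the image of [Q] under the
inverse of [s], which is [P] only for [Q = P]. *)
Lemma aut_RRspace (s : curve_aut K) P m f : (forall x, P (s x) = P x) ->
  f \in RRspace (mul_point m P) -> s f \in RRspace (mul_point m P).
Proof.
move=> sP /asboolP fm; apply/asboolP => Q.
rewrite mul_pointE; have [->|QP] := eqVneq Q P.
  by have := fm P; rewrite sP mul_pointE eqxx.
have := fm (act_point (aut_inv s) Q); rewrite mul_pointE/= aut_inv_inv.
case: eqP => // sQ; case/eqP: QP; apply: point_eqP => h.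
have := congr1 (fun R : curve_point K => R (aut_inv s h)) sQ.
by rewrite /= aut_inv_inv aut_Kinv -(sP (aut_inv s h)) aut_Kinv.
Qed.

End Poles.

(** * The representation *)

Section Representation.
Context (k : closedFieldType) (K : functionFieldType k).
Context (G : groupClosed (curve_aut K)) (i : nat) (P : curve_point K) (m : int).

Local Notation Gi := (sub_of (ramification_group G i P)).
Local Notation L := (sub_of (RRspace (mul_point m P))).

Lemma ramification_group_ord (s : Gi) f : P (val s f) = P f.
Proof. by case: s => s /= /andP[/in_decomposition_group[]]. Qed.

Definition RR_map (s : Gi) (f : L) : L :=
  SubOf (aut_RRspace (ramification_group_ord s) (valP f)).

Lemma RR_mapM (s t : Gi) f : RR_map (s * t)%g f = RR_map s (RR_map t f).
Proof. exact: val_inj. Qed.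

Lemma RR_map1 f : RR_map 1%g f = f.
Proof. exact: val_inj. Qed.

Lemma RR_map_bij s : bijective (RR_map s).
Proof.
by exists (RR_map s^-1%g) => f; rewrite -RR_mapM ?mulVg ?mulgV RR_map1.
Qed.

Lemma RR_map_linear s : linear (RR_map s).
Proof. by move=> a f h; apply: val_inj; rewrite /= aut_linear. Qed.

Definition RR_repr (s : Gi) : GL L := MkGL (RR_map_bij s) (RR_map_linear s).

Lemma RR_reprM : {morph RR_repr : s t / (s * t)%g}.
Proof. by move=> s t; apply: GL_eqP => f; exact: RR_mapM. Qed.

HB.instance Definition _ := isMultiplicative.Build Gi (GL L) RR_repr RR_reprM.

End Representation.

Theorem lemma2p1 (k : closedFieldType) (p : nat) (hp : p \in [pchar k])
    (K : functionFieldType k) (g : nat) (hg : has_genus K g)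
    (G : groupClosed (curve_aut K)) (hG : finite_set [set` G])
    (P : curve_point K) (hP : wildly_ramified p G P)
    (m : nat) (hm : smallest_prime_to_pole_number p P m)
    (hmg : m%:Z <= 2 * g%:Z - 1) :
  exists rho : {multiplicative sub_of (ramification_group G 1 P)
                  -> GL (sub_of (RRspace (mul_point m%:Z P)))},
    injective rho.
Proof.
have [mpole pm _] := hm.
have m0 : (0 < m)%N by case: m pm {hm hmg mpole}; rewrite ?dvdn0.
have [f fL Pf] := pole_number_witness mpole m0.
exists (@RR_repr k K G 1 P m%:Z : {multiplicative _ -> _}) => s t st.
pose u := (t^-1 * s)%g.
have uf : val u f = f.
  have /(congr1 (fun r : GL _ => r (SubOf fL)))/(congr1 val)/= sf := st.
  by rewrite /= sf aut_invK.
have /andP[_ /asboolP u2] := valP u.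
have u1 := aut_eq1_of_fixed_pole hp (ramification_group_ord u) u2 uf Pf pm.
have {}u1 : u = 1%g by apply/val_inj/aut_eqP.
by rewrite -[t]mulg1 -u1 mulgA mulgV mul1g.
Qed.
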